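(* Let $N\ge 1$ and let $Q^N$ be a $\mathcal{Q}^N$ quiver with vertical chains $v^i_1\leftarrow v^i_2\leftarrow\cdots\leftarrow v^i_{k_i}$, $i=1,\dots,N$. Let $>$ be the partial order on its vertex set described in the context, and for each vertex $v^i_\ell$ let $\underline{\mu}_{v^i_\ell}=\mu_{v^i_{k_i-\ell+1}}\circ\mu_{v^i_{k_i-\ell}}\circ\cdots\circ\mu_{v^i_1}$. Let $\{v^{i_1}_{a_1},v^{i_2}_{a_2},\dots,v^{i_n}_{a_n}\}$ be the vertex set of $Q^N$ (all $n=k_1+\cdots+k_N$ vertices listed without repetition) such that, for $1\le j\le n-1$, one has $v^{i_{j+1}}_{a_{j+1}}\not> v^{i_j}_{a_j}$. Then the mutation sequence $$\underline{\mu}=\underline{\mu}_{v^{i_n}_{a_n}}\circ \underline{\mu}_{v^{i_{n-1}}_{a_{n-1}}} \circ \cdots \circ \underline{\mu}_{v^{i_1}_{a_1}}$$ is a maximal green sequence of $Q^N$.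
   Context: Quivers are finite connected directed graphs without loops or 2-cycles. Mutation. An ice quiver $(Q,F)$ is a quiver $Q$ with a subset $F\subset Q_0$ of frozen vertices having no arrows between them. For $k\in Q_0\setminus F$, the mutation $\mu_k$ does: (1) for every two-arrow path $i\to k\to j$ add a new arrow $i\to j$ unless $i,j\in F$; (2) reverse all arrows incident to $k$; (3) repeatedly remove oriented 2-cycles until none remain. Compositions of mutations are performed from right to left. Maximal green sequences. For a quiver $Q$ with vertices $1,\dots,n$, the framed quiver $\widehat{Q}$ is the ice quiver obtained by adding frozen vertices $1',\dots,n'$ and one arrow $i\to i'$ for each $i$. In a quiver obtained from $\widehat Q$ by mutations at non-frozen vertices, a non-frozen vertex $i$ is green if there is no arrow $j'\to i$ from a frozen vertex, and red if there is no arrow $i\to j'$ to a frozen vertex. A sequence $\mu_{\ell_k}\circ\cdots\circ\mu_{\ell_1}$ is a green sequence of $Q$ if $\ell_j$ is green in $\mu_{\ell_{j-1}}\circ\cdots\circ\mu_{\ell_1}(\widehat Q)$ for each $1\le j\le k$; it is a maximal green sequence of $Q$ if moreover all non-frozen vertices are red in $\mu_{\ell_k}\circ\cdots\circ\mu_{\ell_1}(\widehat Q)$. $\mathcal{Q}^N$ quivers. For $N\ge1$, a quiver $Q^N$ is a finite connected quiver with vertex set $\{v^i_\ell\mid 1\le i\le N,\ 1\le \ell\le k_i\}$ (with $k_i\ge1$) whose arrows are exactly: (1) the vertical arrows $v^i_1\leftarrow v^i_2\leftarrow\cdots\leftarrow v^i_{k_i}$ for $i=1,\dots,N$ (the $i$-th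 vertical chain); (2) oblique arrows: for two distinct chains, the arrows between them (if there are any) form exactly one path $v^i_{a_1}\to v^j_{b_1}\to v^i_{a_2}\to v^j_{b_2}\to v^i_{a_3}\to\cdots$ (starting in one of the two chains, called chain $i$, and ending in either), with $1\le a_1<a_2<\cdots\le k_i$ and $1\le b_1<b_2<\cdots\le k_j$; (3) if $3\le m\le N$, $i_1,\dots,i_m$ are pairwise distinct and there is an arrow (in either direction) between the chains $i_r$ and $i_{r+1}$ for each $r=1,\dots,m-1$, then there is no arrow between the chains $i_1$ and $i_m$. Quivers of this form are called $\mathcal{Q}^N$ quivers. Partial order. The partial order $>$ on the vertices of $Q^N$ is generated (by transitivity) by the following relations, where empty lists of vertices are simply omitted. (1) $v^i_1>v^i_2>\cdots>v^i_{k_i}$ for every $i$. (2) For each two chains $i,j$ connected by arrows, with the connecting path starting in chain $i$, put $b_0=0$. (a) If the path is $v^i_{a_1}\to v^j_{b_1}\to\cdots\to v^i_{a_n}\to v^j_{b_n}$ (ending in chain $j$), put $a_{n+1}=k_i$, $b_{n+1}=k_j$; then $v^{i}_{a_{\ell}}>v^{j}_{b_{\ell-1}+1}>\cdots>v^{j}_{b_{\ell}}$ for $\ell=1,\dots,n$; $v^{j}_{b_{\ell}}>v^{i}_{a_{\ell}+1}>\cdots>v^{i}_{a_{\ell+1}}$ for $\ell=1,\dots,n-1$; $v^{j}_{b_n}>v^{i}_{a_{n}+1}>\cdots>v^{i}_{a_{n+1}}>v^{j}_{b_n+1}>\cdots>v^{j}_{b_{n+1}}$. (b) If the path is $v^i_{a_1}\to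 v^j_{b_1}\to\cdots\to v^j_{b_{n-1}}\to v^i_{a_n}$ (ending in chain $i$), put $a_{n+1}=k_i$, $b_n=k_j$; then $v^{i}_{a_{\ell}}>v^{j}_{b_{\ell-1}+1}>\cdots>v^{j}_{b_{\ell}}$ for $\ell=1,\dots,n-1$; $v^{j}_{b_{\ell}}>v^{i}_{a_{\ell}+1}>\cdots>v^{i}_{a_{\ell+1}}$ for $\ell=1,\dots,n-1$; $v^{i}_{a_n}>v^{j}_{b_{n-1}+1}>\cdots>v^{j}_{b_{n}}>v^{i}_{a_n+1}>\cdots>v^{i}_{a_{n+1}}$. (Here $n$ is local to each pair of chains.)
   Formalization: The condition that v_{j+1} is not greater than v_j for consecutive entries is replaced by: no entry is greater than any earlier entry; the consecutive version fails for a→b←c→d (one-vertex chains) with the listing d, a, c, b. *)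

(* Defs.v *)
From Stdlib Require Import Relation_Operators.
From mathcomp Require Import all_boot.

Set Implicit Arguments.
Unset Strict Implicit.
Unset Printing Implicit Defensive.

(* [arr x y] is the number of arrows x -> y.  Connectedness is the separate
   predicate [connected_quiver]. *)
Record quiver (T : finType) := Quiver {
  arr :> T -> T -> nat;
  no_loop : forall x, arr x x = 0;
  no_2cycle : forall x y, arr x y = 0 \/ arr y x = 0 }.

Definition connected_quiver (T : finType) (Q : quiver T) : Prop :=
  forall x y : T, connect (fun u v => (0 < Q u v) || (0 < Q v u)) x y.

Record ice_quiver (T : finType) := IceQuiver {
  quiver_of :> quiver T;
  frozen : pred T;
  no_frozen_arr : forall x y, frozen x -> frozen y -> quiver_of x y = 0 }.

Section Mutation.
Variables (T : finType) (Q : ice_quiver T) (k : T).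

Definition mut_add (i j : T) : nat :=
  Q i j + (if frozen Q i && frozen Q j then 0 else Q i k * Q k j).

Definition mut_rev (i j : T) : nat :=
  if (i == k) || (j == k) then mut_add j i else mut_add i j.

(* Removing oriented 2-cycles one by one until none remain leaves the
   truncated difference of the two multiplicities. *)
Definition mut_arr (i j : T) : nat := mut_rev i j - mut_rev j i.

Lemma mut_no_loop x : mut_arr x x = 0.
Proof. exact: subnn. Qed.

Lemma mut_no_2cycle x y : mut_arr x y = 0 \/ mut_arr y x = 0.
Proof.
rewrite /mut_arr; have [le_xy|/ltnW le_yx] := leqP (mut_rev x y) (mut_rev y x).
  by left; apply/eqP.
by right; apply/eqP.
Qed.

Lemma mut_no_frozen_arr x y : frozen Q x -> frozen Q y -> mut_arr x y = 0.
Proof.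
move=> Fx Fy.
have add0 u v : frozen Q u -> frozen Q v -> mut_add u v = 0.
  by move=> Fu Fv; rewrite /mut_add Fu Fv no_frozen_arr.
by rewrite /mut_arr /mut_rev !add0 // if_same.
Qed.

(* Total in k, but meaningful (and used) only for k not frozen. *)
Definition mutation : ice_quiver T :=
  @IceQuiver T (Quiver mut_no_loop mut_no_2cycle) (frozen Q) mut_no_frozen_arr.

End Mutation.

(* The composition mu_{l_k} o ... o mu_{l_1} is encoded by the sequence
   [:: l_1; ...; l_k], in order of application. *)
Definition mutations (T : finType) (Q : ice_quiver T) (s : seq T) :
  ice_quiver T := foldl (@mutation T) Q s.

Section Framed.
Variables (T : finType) (Q : quiver T).

(* [inl i] is the vertex i and [inr i] is the frozen vertex i'. *)
Definition framed_arr (x y : T + T) : nat :=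
  match x, y with
  | inl i, inl j => Q i j
  | inl i, inr j => (i == j : nat)
  | inr _, _ => 0
  end.

Definition framed_frozen (x : T + T) : bool :=
  if x is inr _ then true else false.

Lemma framed_no_loop x : framed_arr x x = 0.
Proof. by case: x => //= i; apply: no_loop. Qed.

Lemma framed_no_2cycle x y : framed_arr x y = 0 \/ framed_arr y x = 0.
Proof.
by case: x => i; case: y => j /=; [apply: no_2cycle | right | left | left].
Qed.

Lemma framed_no_frozen_arr x y :
  framed_frozen x -> framed_frozen y -> framed_arr x y = 0.
Proof. by case: x => // i; case: y. Qed.

Definition framed : ice_quiver (T + T)%type :=
  @IceQuiver _ (Quiver framed_no_loop framed_no_2cycle) framed_frozen
    framed_no_frozen_arr.

End Framed.

Definition green (T : finType) (Q : ice_quiver T) (i : T) : Prop :=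
  forall f, frozen Q f -> Q f i = 0.

Definition red (T : finType) (Q : ice_quiver T) (i : T) : Prop :=
  forall f, frozen Q f -> Q i f = 0.

Definition green_sequence (T : finType) (Q : quiver T) (s : seq T) : Prop :=
  forall s1 l s2, s = s1 ++ l :: s2 ->
    green (mutations (framed Q) (map inl s1)) (inl l).

Definition maximal_green_sequence (T : finType) (Q : quiver T) (s : seq T) :
  Prop :=
  green_sequence Q s /\
  forall i : T, red (mutations (framed Q) (map inl s)) (inl i).

Definition consecutive (T : eqType) (s : seq T) (x y : T) : bool :=
  (x, y) \in zip s (behead s).

(* [:: x1; y1; x2; y2; ...] *)
Fixpoint zigzag (T : Type) (s t : seq T) : seq T :=
  match s, t with
  | [::], _ => [::]
  | x :: _, [::] => [:: x]
  | x :: s', y :: t' => x :: y :: zigzag s' t'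
  end.

(* Vertices are also denoted by labels: the label (i, l), with
   1 <= l <= k i, stands for v^i_l. *)
Definition vertex (N : nat) (k : 'I_N -> nat) : finType :=
  {i : 'I_N & 'I_(k i)}.

Definition level (N : nat) (k : 'I_N -> nat) (x : vertex k) : nat :=
  (tagged x).+1.

Definition label (N : nat) (k : 'I_N -> nat) (x : vertex k) : 'I_N * nat :=
  (tag x, level x).

Definition chain (N : nat) (k : 'I_N -> nat) (i : 'I_N) : seq (vertex k) :=
  [seq Tagged (fun j => 'I_(k j)) l | l <- enum 'I_(k i)].

Section QN.
Variables (N : nat) (k : 'I_N -> nat) (Q : quiver (vertex k)).

Definition vertical_arrows : Prop :=
  forall x y : vertex k, tag x = tag y -> Q x y = (level x == (level y).+1).

Definition adjacent_chains (i j : 'I_N) : bool :=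
  [exists x : vertex k, exists y : vertex k,
     [&& tag x == i, tag y == j & (0 < Q x y) || (0 < Q y x)]].

(* a and b list the levels on the chains i and j of the vertices of the path
   v^i_{a_1} -> v^j_{b_1} -> v^i_{a_2} -> ...; the path ends in chain j if
   [size a = size b] and in chain i if [size a = (size b).+1].  It has at
   least one arrow. *)
Definition oblique_path (i j : 'I_N) (a b : seq nat) : Prop :=
  [/\ i != j,
      sorted ltn a && all (fun l => 1 <= l <= k i) a,
      sorted ltn b && all (fun l => 1 <= l <= k j) b,
      0 < size b /\ (size a = size b \/ size a = (size b).+1) &
      forall x y : vertex k,
        (tag x = i /\ tag y = j) \/ (tag x = j /\ tag y = i) ->
        Q x y = consecutive (zigzag [seq (i, l) | l <- a]
                                    [seq (j, l) | l <- b])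
                            (label x) (label y)].

Definition is_QN : Prop :=
  [/\ forall i, 1 <= k i,
      connected_quiver Q,
      vertical_arrows,
      forall i j, i != j ->
        [\/ ~~ adjacent_chains i j,
            exists a b, oblique_path i j a b
          | exists a b, oblique_path j i a b] &
      forall (i : 'I_N) (s : seq 'I_N),
        3 <= size (i :: s) <= N -> uniq (i :: s) ->
        path adjacent_chains i s -> ~~ adjacent_chains i (last i s)].

(* The labels of v^i_{p+1}, ..., v^i_q, none if q <= p. *)
Definition segment (i : 'I_N) (p q : nat) : seq ('I_N * nat) :=
  [seq (i, l) | l <- index_iota p.+1 q.+1].

(* [lev i a m] is a_m for 1 <= m <= size a, is 0 for m = 0, and is k_i for
   m = (size a).+1. *)
Definition lev (i : 'I_N) (a : seq nat) (m : nat) : nat :=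
  nth 0 (0 :: rcons a (k i)) m.

(* The displayed sequences ... > ... > ... whose consecutive terms generate
   the order.  In the three rules Desc_ij_*, n = size a = size b; in the three
   rules Desc_ii_*, n = size a = (size b).+1. *)
Inductive descending : seq ('I_N * nat) -> Prop :=
  | Desc_vertical i : descending (segment i 0 (k i))
  | Desc_ij_a i j a b l of
      oblique_path i j a b & size a = size b & 1 <= l <= size a :
      descending ((i, lev i a l) :: segment j (lev j b l.-1) (lev j b l))
  | Desc_ij_b i j a b l of
      oblique_path i j a b & size a = size b & 1 <= l <= (size a).-1 :
      descending ((j, lev j b l) :: segment i (lev i a l) (lev i a l.+1))
  | Desc_ij_end i j a b n of
      oblique_path i j a b & size a = size b & n = size a :
      descending ((j, lev j b n) :: segment i (lev i a n) (lev i a n.+1)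
                                 ++ segment j (lev j b n) (lev j b n.+1))
  | Desc_ii_a i j a b l of
      oblique_path i j a b & size a = (size b).+1 & 1 <= l <= (size a).-1 :
      descending ((i, lev i a l) :: segment j (lev j b l.-1) (lev j b l))
  | Desc_ii_b i j a b l of
      oblique_path i j a b & size a = (size b).+1 & 1 <= l <= (size a).-1 :
      descending ((j, lev j b l) :: segment i (lev i a l) (lev i a l.+1))
  | Desc_ii_end i j a b n of
      oblique_path i j a b & size a = (size b).+1 & n = size a :
      descending ((i, lev i a n) :: segment j (lev j b n.-1) (lev j b n)
                                 ++ segment i (lev i a n) (lev i a n.+1)).

Definition gt_gen (x y : vertex k) : Prop :=
  exists2 s, descending s & consecutive s (label x) (label y).

Definition gt_vertex (x y : vertex k) : Prop := clos_trans _ gt_gen x y.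

End QN.

(* For x = v^i_l: the mutations at v^i_1, ..., v^i_{k_i-l+1}, in order of
   application. *)
Definition underline_mu (N : nat) (k : 'I_N -> nat) (x : vertex k) :
  seq (vertex k) :=
  [seq y <- chain k (tag x) | level y <= k (tag x) - level x + 1].

(* Main.v *)
Require Import Defs.
From mathcomp Require Import all_boot all_order all_algebra.
From mathcomp Require Import zify ring.

Set Implicit Arguments.
Unset Strict Implicit.
Unset Printing Implicit Defensive.

Import Order.TTheory GRing.Theory Num.Theory.

(** The proof follows the c-vectors.  Attach to each vertex x of a mutated
framed quiver the integer vector c_x counting the arrows from x to the frozen
vertices, and let omega be the skew form of Q.  A mutation at a green vertex z
replaces c_z by -c_z and adds to every other c_y a multiple of c_z, the
multiplicity being the positive part of omega(c_y, c_z); this is a base change,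
and the arrows y -> z between mutable vertices remain given by omega(c_y, c_z)
(green_mutation_cvectors).  So the mutated quiver need not be described: it is
enough to know the c-vectors.

For a single chain with k vertices put E(b) = e_1 + ... + e_b.  The c-vectors
are always E(w(l)) - E(w(l-1)), where w is a permutation of 0, ..., k, and the
mutation at v_l exchanges w(l-1) and w(l).  The prescribed sequence is bubble
sort: the sweep for v_1 carries 0 to the last place, the sweep for v_2 carries
1 to the last place but one, and so on, until w is decreasing and every vertex
is red.  The partial sums turn the form omega on a chain into sgn(a - b) plus a
coboundary, so the neighbours of the mutated vertex are read off from w
(omega_prefix_diff, omega_same_chain).

Different chains do not interact: when v is mutated during a sweep, no arrow
reaches v from another chain, that is, omega(c_y, c_v) <= 0 for y in another
chain (omega_cross_chain).  Here c_v is the sum of an interval of basis vectors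
starting at the level p of the current sweep, while c_y is a basis vector e_w
with w unswept, or -e_w with w swept, or minus the sum of the e_w from the last
swept level upwards.  The sign then comes from one property of the order: if
there is an oblique arrow x -> y, and v -> x is the arrow preceding it on its
path, then x precedes in the order the vertex directly above v in the chain of
y, or the first vertex of that chain if x -> y starts the path
(oblique_predecessor).  Each arrow counted with the wrong sign is thereby
matched with a preceding arrow counted with the right sign. *)

(** * Mutation at a green vertex in terms of c-vectors *)

Section CVectors.
Variables (T : finType) (Q : quiver T).
Local Open Scope ring_scope.

Definition net (U : finType) (R : quiver U) (x y : U) : int :=
  (R x y)%:Z - (R y x)%:Z.

Lemma netC (U : finType) (R : quiver U) x y : net R x y = - net R y x.
Proof. by rewrite opprB. Qed.

Lemma arr_net (U : finType) (R : quiver U) x y :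
  (R x y)%:Z = Num.max 0 (net R x y).
Proof. by rewrite /net; have := no_2cycle R x y; lia. Qed.

(** Removing 2-cycles does not change the signed number of arrows, so mutation
is the usual formula on skew-symmetric matrices. *)
Lemma net_mutation (U : finType) (R : ice_quiver U) z x y :
  ~~ (frozen R x && frozen R y) ->
  net (mutation R z) x y =
    if (x == z) || (y == z) then - net R x y
    else net R x y + (R x z)%:Z * (R z y)%:Z - (R y z)%:Z * (R z x)%:Z.
Proof.
move=> nF; have nF' : ~~ (frozen R y && frozen R x) by rewrite andbC.
rewrite /net /= /mut_arr /mut_rev orbC /mut_add (negbTE nF) (negbTE nF').
have Rz0 := no_loop R z.
have [->|_] := eqVneq y z; first by rewrite /= Rz0; lia.
have [->|_] := eqVneq x z; first by rewrite /= Rz0; lia.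
by rewrite /=; lia.
Qed.

Definition omega (u v : T -> int) : int :=
  \sum_x \sum_y u x * v y * net Q x y.

Lemma eq_omega u u' v v' : u =1 u' -> v =1 v' -> omega u v = omega u' v'.
Proof.
by move=> eu ev; apply: eq_bigr => x _; apply: eq_bigr => y _; rewrite eu ev.
Qed.

Lemma omegaC u v : omega u v = - omega v u.
Proof.
rewrite /omega exchange_big -sumrN; apply: eq_bigr => x _ /=.
rewrite -sumrN; apply: eq_bigr => y _; rewrite netC; ring.
Qed.

Lemma omega_linearl a u v w :
  omega (fun f => u f + a * v f) w = omega u w + a * omega v w.
Proof.
rewrite /omega mulr_sumr -big_split; apply: eq_bigr => x _ /=.
rewrite mulr_sumr -big_split; apply: eq_bigr => y _ /=; ring.
Qed.

Lemma omega_linearr a u v w :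
  omega w (fun f => u f + a * v f) = omega w u + a * omega w v.
Proof. by rewrite omegaC omega_linearl opprD -mulrN -!omegaC. Qed.

(** The second field identifies c with the c-vectors; the third, that omega
computes all arrows between mutable vertices, is what makes a description of the
quiver by its c-vectors alone possible. *)
Record has_cvectors (c : T -> T -> int) (R : ice_quiver (T + T)%type) : Prop := {
  frozenE : frozen R =1 @framed_frozen T;
  net_frozen : forall x f, net R (inl x) (inr f) = c x f;
  net_mutable : forall x y, net R (inl x) (inl y) = omega (c x) (c y) }.

Lemma eq_has_cvectors c c' R :
  (forall x f, c x f = c' x f) -> has_cvectors c R -> has_cvectors c' R.
Proof.
move=> ec [F S M]; split=> // [x f|x y]; first by rewrite S ec.
by rewrite M; apply: eq_omega => f; rewrite ec.
Qed.

Lemma framed_cvectors : has_cvectors (fun x f => (f == x)%:Z) (framed Q).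
Proof.
split=> // [x f|x y]; first by rewrite /net /= subr0 eq_sym.
rewrite /omega (bigD1 x) //= (bigD1 y) //= !eqxx !mul1r.
rewrite !big1 ?addr0 // => [u ux|u uy]; last by rewrite (negbTE uy) mulr0 mul0r.
by rewrite big1 // => v _; rewrite (negbTE ux) !mul0r.
Qed.

Lemma cvector_green c R z :
  has_cvectors c R -> (forall f, 0 <= c z f) -> green R (inl z).
Proof.
move=> [F S _] cz [f|f]; rewrite F // => _.
by have := cz f; have := no_2cycle R (inl z) (inr f); rewrite -S /net; lia.
Qed.

Lemma cvector_red c R z :
  has_cvectors c R -> (forall f, c z f <= 0) -> red R (inl z).
Proof.
move=> [F S _] cz [f|f]; rewrite F // => _.
by have := cz f; have := no_2cycle R (inl z) (inr f); rewrite -S /net; lia.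
Qed.

Definition green_cvector (c : T -> T -> int) (z y f : T) : int :=
  if y == z then - c z f
  else c y f + Num.max 0 (omega (c y) (c z)) * c z f.

(** The third field is preserved by bilinearity, once [omega x z] is written as
the difference of its positive and negative parts, the numbers of arrows
x -> z and z -> x. *)
Lemma green_mutation_cvectors c R z :
  has_cvectors c R -> (forall f, 0 <= c z f) ->
  has_cvectors (green_cvector c z) (mutation R (inl z)).
Proof.
move=> [F S M] cz; have Mz x := arr_net R (inl x) (inl z).
have Mz' x := arr_net R (inl z) (inl x).
have oN u : omega (fun f => - c z f) u = - omega (c z) u.
  rewrite /omega -sumrN; apply: eq_bigr => x _.
  by rewrite -sumrN; apply: eq_bigr => y _; ring.
have ozz : omega (c z) (c z) = 0 by have := omegaC (c z) (c z); lia.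
split=> // [x f|x y].
  rewrite net_mutation ?F ?andbF //= orbF /green_cvector (inj_eq inl_inj).
  case: eqVneq => [->|_]; first by rewrite S.
  rewrite S Mz M !arr_net (netC _ (inr f)) !S.
  by have := cz f; lia.
rewrite net_mutation ?F //= /green_cvector !(inj_eq inl_inj).
case: (eqVneq x z) => [->|xz]; case: (eqVneq y z) => [->|yz] /=.
- by rewrite M oN ozz (omegaC (c z) (fun f => - c z f)) oN ozz.
- by rewrite M oN (omega_linearr _ (c y) (c z)) ozz mulr0 addr0.
- rewrite M (omegaC _ (fun f => - c z f)) oN.
  by rewrite (omega_linearr _ (c x) (c z)) ozz mulr0 addr0
     opprK omegaC opprK.
rewrite M !Mz !Mz' !M (omega_linearl _ (c x) (c z)).
rewrite !(omega_linearr _ (c y) (c z)) ozz.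
rewrite !(omegaC (c z)) mulr0 addr0.
set a := omega (c x) (c z); set b := omega (c y) (c z).
have maxN (t : int) : Num.max 0 (- t) = Num.max 0 t - t by lia.
rewrite !maxN; ring.
Qed.
End CVectors.

(** * Oblique arrows and the partial order *)

Section Consecutive.
Variable T : eqType.
Implicit Types (x y : T) (s t : seq T).

Lemma consecutive_cons2 x1 x2 s x y :
  consecutive (x1 :: x2 :: s) x y =
    (x == x1) && (y == x2) || consecutive (x2 :: s) x y.
Proof. by rewrite /consecutive /= in_cons xpair_eqE. Qed.

Lemma consecutive_cat s1 x y s2 : consecutive (s1 ++ x :: y :: s2) x y.
Proof.
elim: s1 => [|z [|z' s1] IH]; rewrite ?cat_cons ?cat0s ?consecutive_cons2.
- by rewrite !eqxx.
- by rewrite !eqxx orbT.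
by rewrite IH orbT.
Qed.

(** Exchanging the two lists makes one step of the zigzag uniform, which allows
an induction on the total length. *)
Lemma zigzag_cons x s t : zigzag (x :: s) t = x :: zigzag t s.
Proof.
by elim: t x s => [|y t IH] x [|x' s] //=; rewrite -IH.
Qed.

Lemma consecutive_zigzag x0 s t x y :
  consecutive (zigzag s t) x y <->
  (exists n, [/\ n < size s, n < size t, x = nth x0 s n & y = nth x0 t n]) \/
  (exists n, [/\ n < size t, n.+1 < size s, x = nth x0 t n &
                 y = nth x0 s n.+1]).
Proof.
have [m] := ubnP (size s + size t); elim: m s t => // m IH [|x1 s] t.
  by split=> // -[[n []]|[n []]].
rewrite zigzag_cons; case: t => [|x2 t].
  by split=> // -[[n []]|[n []]].
rewrite zigzag_cons consecutive_cons2 -zigzag_cons /= addSn ltnS => le_m.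
have {}IH := IH (x2 :: t) s; rewrite /= addSnnS addnC addSnnS in IH.
split=> [/orP[/andP[/eqP-> /eqP->]|/(IH le_m)]|]; first by left; exists 0.
  case=> [[n [lt_t lt_s -> ->]]|[n [lt_t lt_s -> ->]]].
    by right; exists n.
  by left; exists n.+1.
case=> [[[|n] /= [lt_s lt_t ex ey]]|[n /= [lt_t lt_s ex ey]]].
- by rewrite ex ey !eqxx.
- by apply/orP; right; apply/(IH le_m); right; exists n.
- by apply/orP; right; apply/(IH le_m); left; exists n.
Qed.
End Consecutive.

Section Vertices.
Variables (N : nat) (k : 'I_N -> nat).
Implicit Types (x y u : vertex k) (i j : 'I_N).

Definition vert i (l : 'I_(k i)) : vertex k := Tagged (fun j => 'I_(k j)) l.

Lemma vertex_inj x y : tag x = tag y -> tagged x = tagged y :> nat -> x = y.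
Proof.
by case: x y => i l [j l'] /= ij; case: _ / ij l' => l' /= /ord_inj->.
Qed.

Lemma ltn_tagged x : tagged x < k (tag x). Proof. exact: ltn_ord. Qed.

Lemma exists_vertex i l : l < k i ->
  exists x : vertex k, tag x = i /\ tagged x = l :> nat.
Proof. by move=> lt_l; exists (vert (Ordinal lt_l)). Qed.

Lemma consecutive_segment i p q l :
  p < l < q -> consecutive (segment i p q) (i, l) (i, l.+1).
Proof.
move=> /andP[pl lq]; rewrite /segment /index_iota.
have -> : q.+1 - p.+1 = l - p.+1 + (q - l.+1).+2 by lia.
rewrite iotaD map_cat subnKC //; exact: consecutive_cat.
Qed.

Lemma consecutive_cons_segment (z : 'I_N * nat) i p q :
  p < q -> consecutive (z :: segment i p q) z (i, p.+1).
Proof.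
move=> pq; rewrite /segment /index_iota.
have -> : q.+1 - p.+1 = (q - p.+1).+1 by lia.
by rewrite /= consecutive_cons2 !eqxx.
Qed.
End Vertices.

Section ObliqueArrows.
Variables (N : nat) (k : 'I_N -> nat) (Q : quiver (vertex k)).
Hypothesis QN : is_QN Q.
Implicit Types (x y u v w : vertex k) (i j : 'I_N).

Lemma gt_gen_vertical u v :
  tag u = tag v -> tagged v = (tagged u).+1 :> nat -> gt_gen Q u v.
Proof.
move=> tuv uv; exists (segment (tag u) 0 (k (tag u))); first exact: Desc_vertical.
rewrite /label -tuv /level uv; apply: consecutive_segment.
by have := ltn_tagged v; rewrite uv -tuv.
Qed.

Lemma arrow_oblique_path x y : tag x != tag y -> 0 < Q x y ->
  exists i j a b, oblique_path Q i j a b /\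
    ((tag x = i /\ tag y = j) \/ (tag x = j /\ tag y = i)).
Proof.
move=> xy Qxy; have [_ _ _ /(_ _ _ xy) obl _] := QN.
case: obl => [/existsP[]|[a [b ob]]|[a [b ob]]].
- by exists x; apply/existsP; exists y; rewrite !eqxx Qxy.
- by exists (tag x), (tag y), a, b; split=> //; left.
- by exists (tag y), (tag x), a, b; split=> //; right.
Qed.

Lemma lev_nth i (a : seq nat) n : n < size a -> lev k i a n.+1 = nth 0 a n.
Proof. by move=> lt_n; rewrite /lev /= nth_rcons lt_n. Qed.

Lemma oblique_arrow x y i j a b : oblique_path Q i j a b ->
  ((tag x = i /\ tag y = j) \/ (tag x = j /\ tag y = i)) -> 0 < Q x y ->
  (exists n, [/\ n < size a, n < size b, label x = (i, nth 0 a n) &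
                 label y = (j, nth 0 b n)]) \/
  (exists n, [/\ n < size b, n.+1 < size a, label x = (j, nth 0 b n) &
                 label y = (i, nth 0 a n.+1)]).
Proof.
case=> _ _ _ _ QE tags; rewrite QE // lt0b => /(consecutive_zigzag (i, 0)).
rewrite !size_map => -[[n [na nb]]|[n [nb na]]]; rewrite !(nth_map 0) // => lx ly.
  by left; exists n.
by right; exists n.
Qed.

Lemma oblique_arrow_le1 x y : tag x != tag y -> Q x y <= 1.
Proof.
move=> xy; have [->//|Q_gt0] := posnP (Q x y).
have [i [j [a [b [[_ _ _ _ QE] tags]]]]] := arrow_oblique_path xy Q_gt0.
by rewrite QE // leq_b1.
Qed.

(** The levels along an oblique path increase strictly, so the path visits a
vertex at most once. *)
Lemma oblique_arrow_out x y y' : tag x != tag y -> tag y = tag y' ->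
  0 < Q x y -> 0 < Q x y' -> y = y'.
Proof.
move=> xy yy' Qxy Qxy'; apply: vertex_inj => //.
have [i [j [a [b [ob tags]]]]] := arrow_oblique_path xy Qxy.
have [ij /andP[sa _] /andP[sb _] _ _] := ob.
have ua := sorted_uniq ltn_trans ltnn sa.
have ub := sorted_uniq ltn_trans ltnn sb.
have tags' := tags; rewrite yy' in tags'.
have neq : i <> j by apply/eqP.
case: (oblique_arrow ob tags Qxy) => -[n [n1 n2 [ex lx] [ey ly]]];
case: (oblique_arrow ob tags' Qxy') => -[n' [n1' n2' [ex' lx'] [ey' ly']]].
- have := nth_uniq 0 n1 n1' ua; rewrite -lx -lx' eqxx => /esym/eqP nn.
  by rewrite -nn -ly in ly'; case: ly'.
- by case: neq; rewrite -ex -ex'.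
- by case: neq; rewrite -ex -ex'.
- have := nth_uniq 0 n1 n1' ub; rewrite -lx -lx' eqxx => /esym/eqP nn.
  by rewrite -nn -ly in ly'; case: ly'.
Qed.

Lemma exists_label i l : 1 <= l <= k i -> exists x : vertex k, label x = (i, l).
Proof.
case: l => // l /(@exists_vertex _ k)[x [tx lx]]; exists x.
by rewrite /label /level lx tx.
Qed.

(** This is how the order between two chains enters the proof.  The vertex [u] directly follows, in the chain of [y], the
source [v] of the arrow that precedes [x -> y] on the path; it is the first
vertex of the chain if [x -> y] is the first arrow of the path.  The relation
[x > u] is the beginning of the defining relation whose segment ends at [y]. *)
Lemma oblique_predecessor x y : tag x != tag y -> 0 < Q x y ->
  exists u, [/\ tag u = tag y, tagged u <= tagged y, gt_gen Q x u &
    tagged u = 0 :> nat \/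
    exists v, [/\ tag v = tag y, tagged u = (tagged v).+1 :> nat & 0 < Q v x]].
Proof.
move=> xy Qxy.
have [i [j [a [b [ob tags]]]]] := arrow_oblique_path xy Qxy.
have [ij /andP[sa /allP ka] /andP[sb /allP kb] [b0 sab] QE] := ob.
have nt (s : seq nat) n n' : sorted ltn s -> n < n' -> n' < size s ->
    nth 0 s n < nth 0 s n'.
  move=> ss nn' n's; apply: (sorted_ltn_nth ltn_trans) => //; rewrite inE //.
  exact: ltn_trans nn' n's.
have gen z l p q : descending Q (z :: segment l p q) -> label x = z ->
    tag y = l -> level y = q -> p < q ->
    (p = 0 \/ exists v, label v = (l, p) /\ 0 < Q v x) ->
    exists u, [/\ tag u = tag y, tagged u <= tagged y, gt_gen Q x u &
      tagged u = 0 :> nat \/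
      exists v, [/\ tag v = tag y, tagged u = (tagged v).+1 :> nat & 0 < Q v x]].
  move=> dz xz tyl; rewrite -{}tyl in dz * => yq pq pv; have yk := ltn_tagged y.
  have [|u [tu lu]] := @exists_vertex _ k (tag y) p; first by rewrite /level in yq; lia.
  exists u; split=> //; first by rewrite /level in yq; lia.
    exists (z :: segment (tag y) p q) => //.
    by rewrite xz /label /level lu tu; apply: consecutive_cons_segment.
  case: pv => [p0|[v [[tv lv] Qvx]]]; first by left; rewrite lu.
  by right; exists v; rewrite -lv in lu.
have notb0 n : n < size b -> 0 < nth 0 b n.
  by move=> nb; have /kb/andP[] := mem_nth 0 nb.
case: (oblique_arrow ob tags Qxy) => -[n [n1 n2 lx [ty ly]]].
  apply: (gen (i, lev k i a n.+1) j (lev k j b n) (lev k j b n.+1)).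
  - case: sab => sab; first by apply: Desc_ij_a; eauto; lia.
    by apply: Desc_ii_a; eauto; lia.
  - by rewrite lev_nth.
  - by [].
  - by rewrite lev_nth.
  - rewrite lev_nth //; case: n n1 n2 {lx ly} => [|n] n1 n2; first exact: notb0.
    by rewrite lev_nth; [apply: nt | lia].
  case: n n1 n2 lx ly => [|n] n1 n2 lx ly; [by left | right].
  rewrite lev_nth; last lia.
  have nb : n < size b by lia.
  have [v lv] := exists_label (kb _ (mem_nth 0 nb)).
  exists v; split=> //; rewrite QE ?lv ?lx; last first.
    by have [tv _] := lv; have [tx _] := lx; right; rewrite -tv -tx.
  rewrite lt0b; apply/(consecutive_zigzag (i, 0)); right; exists n.
  by rewrite !size_map !(nth_map 0) //; split.
apply: (gen (j, lev k j b n.+1) i (lev k i a n.+1) (lev k i a n.+2)).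
- case: sab => sab; first by apply: Desc_ij_b; eauto; lia.
  by apply: Desc_ii_b; eauto; lia.
- by rewrite lev_nth.
- by [].
- by rewrite lev_nth.
- by rewrite !lev_nth ?nt //; lia.
have na : n < size a by lia.
right; rewrite lev_nth //; have [v lv] := exists_label (ka _ (mem_nth 0 na)).
exists v; split=> //; rewrite QE ?lv ?lx; last first.
  by have [tv _] := lv; have [tx _] := lx; left; rewrite -tv -tx.
rewrite lt0b; apply/(consecutive_zigzag (i, 0)); left; exists n.
by rewrite !size_map !(nth_map 0) //; split.
Qed.
End ObliqueArrows.

(** * The skew form on a chain *)

Section ChainForm.
Variables (N : nat) (k : 'I_N -> nat) (Q : quiver (vertex k)).
Hypothesis QN : is_QN Q.
Implicit Types (x y z f : vertex k) (i j : 'I_N) (a b c d : nat).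
Local Open Scope ring_scope.

Definition chain_prefix i b f : int := ((tag f == i) && (tagged f < b)%N)%:Z.

(** Written with a coefficient [-1] so that the linearity lemmas for [omega]
apply to it. *)
Definition prefix_diff i a b f : int := chain_prefix i b f + (-1) * chain_prefix i a f.

Lemma sum_chain i (F : vertex k -> int) :
  \sum_(x | tag x == i) F x = \sum_(l < k i) F (vert l).
Proof.
transitivity (\sum_(j | j == i) \sum_(l < k j) F (vert l)).
  2: by rewrite big_pred1_eq.
rewrite (@sig_big_dep _ _ _ _ (fun j => 'I_(k j)) _ (fun j l => true)) /=.
by apply: eq_big => [x|[]//]; rewrite andbT.
Qed.

Lemma sum_chain_prefix i b (F : nat -> int) : (b <= k i)%N ->
  \sum_x chain_prefix i b x * F (tagged x) = \sum_(l < b) F l.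
Proof.
move=> bk; rewrite (bigID (fun x => tag x == i)) /= addrC big1 ?add0r; last first.
  by move=> x /negbTE xi; rewrite /chain_prefix xi mul0r.
rewrite sum_chain (big_ord_widen (k i) F bk) [in RHS]big_mkcond /=.
apply: eq_bigr => l _; rewrite /chain_prefix /= eqxx /=.
by case: ifP => _; rewrite ?mul1r ?mul0r.
Qed.

Lemma sum_succ a b : \sum_(l < a) \sum_(l' < b) (l == l'.+1 :> nat)%:Z = (minn b a.-1)%:Z.
Proof.
have inner l : \sum_(l' < b) (l == l'.+1 :> nat)%:Z = (0 < l <= b)%N%:Z.
  elim: b => [|b IH]; first by rewrite big_ord0; lia.
  by rewrite big_ord_recr /= IH; lia.
under eq_bigr do rewrite inner.
elim: a => [|a IH]; first by rewrite big_ord0; lia.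
by rewrite big_ord_recr /= IH; lia.
Qed.

(** The arrows go from the level l+1 to the level l, so the form counts the
pairs of successive levels below the two bounds, in both orders. *)
Lemma omega_chain_prefix i a b : (a <= k i)%N -> (b <= k i)%N ->
  omega Q (chain_prefix i a) (chain_prefix i b) = (minn b a.-1)%:Z - (minn a b.-1)%:Z.
Proof.
move=> ak bk; have [_ _ vertQ _ _] := QN.
pose G (l l' : nat) : int := (l == l'.+1)%:Z - (l' == l.+1)%:Z.
transitivity (\sum_x chain_prefix i a x *
    \sum_y chain_prefix i b y * G (tagged x) (tagged y)).
  apply: eq_bigr => x _; rewrite mulr_sumr; apply: eq_bigr => y _; rewrite -mulrA.
  rewrite {1 3}/chain_prefix; case: eqP => [xi|]; last by rewrite !mul0r.
  congr (_ * _); rewrite /chain_prefix; case: eqP => [yi|]; last by rewrite !mul0r.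
  congr (_ * _); rewrite /net (vertQ x y) ?(vertQ y x) ?xi ?yi // /level /G; lia.
under eq_bigr => x _ do rewrite (sum_chain_prefix (G (tagged x)) bk).
rewrite (sum_chain_prefix (fun l => \sum_(l' < b) G l l') ak) /G.
under eq_bigr do rewrite sumrB.
by rewrite sumrB sum_succ exchange_big sum_succ.
Qed.

Definition sgn_diff a b : int := (b < a)%N%:Z - (a < b)%N%:Z.

(** On prefixes the form is sgn(a - b) + [a = 0] - [b = 0]; the two last terms
form a coboundary and cancel in differences of prefixes. *)
Lemma omega_prefix_diff i a b c d :
  (a <= k i)%N -> (b <= k i)%N -> (c <= k i)%N -> (d <= k i)%N ->
  omega Q (prefix_diff i a b) (prefix_diff i c d) =
    sgn_diff b d - sgn_diff b c - sgn_diff a d + sgn_diff a c.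
Proof.
move=> ak bk ck dk.
have sgnE m n : (minn n m.-1)%:Z - (minn m n.-1)%:Z =
    sgn_diff m n + (m == 0%N)%:Z - (n == 0%N)%:Z by rewrite /sgn_diff; lia.
rewrite (omega_linearl Q (-1) (chain_prefix i b) (chain_prefix i a)).
rewrite !(omega_linearr Q (-1) (chain_prefix i d) (chain_prefix i c)).
rewrite !omega_chain_prefix // !sgnE; ring.
Qed.

Lemma prefix_diffE i a b f : (a <= b)%N ->
  prefix_diff i a b f = ((tag f == i) && (a <= tagged f < b)%N)%:Z.
Proof. by rewrite /prefix_diff /chain_prefix; case: eqP => //= _; lia. Qed.

Lemma prefix_diffN i a b f : prefix_diff i a b f = - prefix_diff i b a f.
Proof. by rewrite /prefix_diff; ring. Qed.

Lemma sum_prefix_diff (F : vertex k -> int) i a b : (a <= b)%N ->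
  \sum_w prefix_diff i a b w * F w =
  \sum_(w : vertex k | (tag w == i) && (a <= tagged w < b)%N) F w.
Proof.
move=> ab; rewrite [RHS]big_mkcond; apply: eq_bigr => w _; rewrite prefix_diffE //.
by case: (_ && _); rewrite ?mul1r ?mul0r.
Qed.

End ChainForm.

(** * Sums, words and green runs *)

Lemma leq_sum_unique (I : finType) (P : pred I) (F G : I -> nat) :
  (forall x, P x -> F x <= 1) ->
  (forall x y, P x -> P y -> 0 < F x -> 0 < F y -> x = y) ->
  (forall x, P x -> 0 < F x -> exists2 y, P y & 0 < G y) ->
  \sum_(x | P x) F x <= \sum_(x | P x) G x.
Proof.
move=> F1 Funiq FG.
have [/existsP[x /andP[Px Fx]]|/existsPn F0] := boolP [exists x, P x && (0 < F x)].
  have [y Py Gy] := FG x Px Fx.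
  rewrite (bigD1 x) //= big1 => [|z /andP[Pz zx]].
    by rewrite (bigD1 y Py) /=; have := F1 x Px; lia.
  apply/eqP; rewrite -leqn0 leqNgt; apply: contraNN zx => Fz.
  by apply/eqP; apply: Funiq.
by rewrite big1 // => x Px; have := F0 x; rewrite Px /=; lia.
Qed.

(** The value at the place [t] of the permutation of 0, ..., n attained by a
chain of n vertices after [p] sweeps and [m] mutations of the next one:
p+1, ..., p+m, p, p+m+1, ..., n, p-1, ..., 0. *)
Definition word (n p m t : nat) : nat :=
  if t < m then p + t.+1 else if t == m then p
  else if t <= n - p then p + t else n - t.

Lemma word_lt n p m t : t < m -> word n p m t = p + t.+1.
Proof. by rewrite /word => ->. Qed.

Lemma word_eq n p m : word n p m m = p.
Proof. by rewrite /word ltnn eqxx. Qed.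

Lemma word_succ n p m : m < n - p -> word n p m m.+1 = p + m.+1.
Proof. by move=> mn; rewrite /word ltnNge leqnSn mn eqn_leq ltnn. Qed.

(** The mutation of rank m, at the vertex between the places m and m+1,
exchanges the values at these places. *)
Lemma word_step n p m t : word n p m.+1 t =
  if t == m then p + m.+1 else if t == m.+1 then p else word n p m t.
Proof.
rewrite /word; have [tm|tm|->] := ltngtP t m; last by rewrite ltnSn.
  by rewrite (leqW tm) ltn_eqF // (leqW tm).
by rewrite ltnNge tm.
Qed.

Lemma word_outside n p m t : m.+1 < t <= n -> m < n - p ->
  (word n p m t < p) || (p + m.+1 < word n p m t).
Proof.
move=> /andP[mt tn] mn; rewrite /word (ltnNge t m) (ltnW (ltnW mt)) gtn_eqF ?(ltnW mt) //=.
by case: ifP; lia.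
Qed.

Section GreenRun.
Variable T : finType.

(** Green sequences read from an arbitrary quiver onwards, for induction on the
sequence. *)
Fixpoint green_run (R : ice_quiver (T + T)%type) (s : seq T) : Prop :=
  if s is z :: s' then green R (inl z) /\ green_run (mutation R (inl z)) s'
  else True.

Lemma green_run_cat R s s' :
  green_run R (s ++ s') <->
  green_run R s /\ green_run (mutations R (map inl s)) s'.
Proof. by elim: s R => [|z s IH] R /=; [tauto | rewrite IH; tauto]. Qed.

Lemma green_run_sequence (Q : quiver T) s :
  green_run (framed Q) s -> green_sequence Q s.
Proof.
by move=> gs s1 z s2 es; move: gs; rewrite es => /green_run_cat[_ []].
Qed.

Lemma mutations_cat (R : ice_quiver (T + T)%type) (s s' : seq T) :
  mutations R (map inl (s ++ s')) = mutations (mutations R (map inl s)) (map inl s').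
Proof. by rewrite map_cat /mutations foldl_cat. Qed.
End GreenRun.

Lemma label_underline_mu N (k : 'I_N -> nat) (x : vertex k) :
  map (@label N k) (underline_mu x) =
    [seq (tag x, l) | l <- iota 1 (k (tag x) - tagged x)].
Proof.
rewrite /underline_mu /chain filter_map -map_comp.
have xk := ltn_tagged x; have -> : k (tag x) - level x + 1 = k (tag x) - tagged x.
  by rewrite /level; lia.
rewrite -(@filter_iota_ltn 1 (k (tag x))) ?leq_subr // -(addn0 1) iotaDl addn0.
rewrite filter_map -map_comp -val_enum_ord filter_map -map_comp.
by congr map; apply: eq_filter => l.
Qed.

(** * One sweep *)

Section WordVectors.
Variables (N : nat) (k : 'I_N -> nat).

Definition word_cvector (W : 'I_N -> nat -> nat) (y : vertex k) : vertex k -> int :=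
  prefix_diff (tag y) (W (tag y) (tagged y)) (W (tag y) (tagged y).+1).

(** The c-vectors once, in each chain [i], exactly the levels below [p i] have
been swept. *)
Definition swept_cvector (p : 'I_N -> nat) :=
  word_cvector (fun i => word (k i) (p i) 0).

Definition incr_at (i : 'I_N) (p : 'I_N -> nat) : 'I_N -> nat :=
  fun j => p j + (j == i).
End WordVectors.

(** In this section the levels below [p i] of each chain [i] have been swept and
[x0] is the vertex whose sweep is under way; [closed] says that all vertices
greater than a swept vertex or than [x0] have been swept. *)
Section Sweep.
Variables (N : nat) (k : 'I_N -> nat) (Q : quiver (vertex k)).
Hypothesis QN : is_QN Q.
Implicit Types (x y z f u v w : vertex k) (i j : 'I_N).
Variables (p : 'I_N -> nat) (x0 : vertex k).
Hypothesis p_le : forall i, p i <= k i.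
Hypothesis x0p : tagged x0 = p (tag x0) :> nat.
Hypothesis closed : forall z u, gt_gen Q z u -> z <> u ->
  tagged u < p (tag u) \/ u = x0 -> tagged z < p (tag z).
Let i0 := tag x0.

(** If [v] were the target of the first arrow of the path, or the preceding
arrow started at a swept level, then [w] would be greater than [x0] or than a
swept vertex, hence swept. *)
Lemma arrow_into_sweep w v : tag w != i0 -> tag v = i0 -> p (tag w) <= tagged w ->
  0 < Q w v ->
  exists v', [/\ tag v' = i0, p i0 <= tagged v', tagged v' < tagged v & 0 < Q v' w].
Proof.
move=> wi vi pw Qwv; have wv : tag w != tag v by rewrite vi.
have [u [tu uv gtu pred_u]] := oblique_predecessor QN wv Qwv.
have nwu : w <> u by move=> wu; rewrite wu tu eqxx in wv.
have ui : tag u = i0 by rewrite tu vi.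
have pui : p (tag u) = p i0 by rewrite ui.
have [pu|up] := leqP (tagged u) (p (tag u)).
  have : tagged w < p (tag w).
    apply: (closed gtu) => //; move: pu.
    rewrite leq_eqVlt => /orP[/eqP pu|]; last by left.
    by right; apply: vertex_inj => //; rewrite x0p pu pui.
  by rewrite ltnNge pw.
case: pred_u => [u0|[v' [tv' uv' Qv'w]]]; first by rewrite u0 in up.
by exists v'; split=> //; [rewrite tv' vi | lia | lia].
Qed.

(** By [oblique_predecessor], [v] is greater than the vertex following the
source [w'] of the preceding arrow; as [v] is not swept, neither is that vertex,
so [w'] lies at the last swept level or above. *)
Lemma arrow_from_sweep v w : tag w != i0 -> tag v = i0 -> p i0 <= tagged v ->
  0 < Q v w -> p (tag w) <= tagged w /\ (0 < p (tag w) ->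
    exists w', [/\ tag w' = tag w, p (tag w) <= (tagged w').+1 & 0 < Q w' v]).
Proof.
move=> wi vi pv Qvw; have vw : tag v != tag w by rewrite vi eq_sym.
have [u [tu uw gtu pred_u]] := oblique_predecessor QN vw Qvw.
have nvu : v <> u by move=> vu; rewrite vu tu eqxx in vw.
have puw : p (tag u) = p (tag w) by rewrite tu.
have pvi : p (tag v) = p i0 by rewrite vi.
have pu : p (tag w) <= tagged u.
  rewrite leqNgt; apply/negP => pu.
  have : tagged v < p (tag v) by apply: (closed gtu) => //; left; rewrite puw.
  by rewrite pvi ltnNge pv.
split=> [|p_gt0]; first by lia.
case: pred_u => [u0|[w' [tw' uw' Qw'v]]]; first by lia.
by exists w'; split=> //; lia.
Qed.

Local Open Scope ring_scope.

(** By [omega_flow] below, this is the value of [omega] on the basis vector of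
[w] and the c-vector of the vertex mutated after [m] mutations of the sweep. *)
Definition flow m w : int :=
  \sum_(v : vertex k | (tag v == i0) && (p i0 <= tagged v < p i0 + m.+1)%N) net Q w v.

Lemma flow_unprocessed m w : tag w != i0 -> (p (tag w) <= tagged w)%N ->
  flow m w <= 0.
Proof.
move=> wi pw; rewrite /flow sumrB subr_le0 -!(big_morph _ PoszD erefl) lez_nat.
apply: leq_sum_unique => [v /andP[/eqP vi _]|v v'|v].
- by apply: (oblique_arrow_le1 QN); rewrite vi.
- move=> /andP[/eqP vi _] /andP[/eqP vi' _] Qwv Qwv'.
  by apply: (oblique_arrow_out QN _ _ Qwv Qwv'); rewrite vi ?vi'.
move=> /andP[/eqP vi /andP[pv vp]] Qwv.
have [v' [vi' pv' vv' Qvw]] := arrow_into_sweep wi vi pw Qwv.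
by exists v' => //; apply/and3P; split; [apply/eqP | | apply: ltn_trans vp].
Qed.

Lemma flow_processed m w : tag w != i0 -> (tagged w < p (tag w))%N ->
  0 <= flow m w.
Proof.
move=> wi wp; rewrite /flow; apply: sumr_ge0 => v /andP[/eqP vi /andP[pv _]].
have [Qvw0|Qvw] := posnP (Q v w); first by rewrite /net Qvw0; lia.
by have [] := arrow_from_sweep wi vi pv Qvw; rewrite leqNgt wp.
Qed.

(** Here the sum starts at the last swept level of the chain [j]: the sources
[w'] given by [arrow_from_sweep] may lie on that level. *)
Lemma sum_flow_ge0 m j : j != i0 -> (0 < p j)%N ->
  0 <= \sum_(w : vertex k | (tag w == j) && (p j <= (tagged w).+1)%N) flow m w.
Proof.
move=> ji pj; rewrite /flow exchange_big /=.
apply: sumr_ge0 => v /andP[/eqP vi /andP[pv _]].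
rewrite sumrB subr_ge0 -!(big_morph _ PoszD erefl) lez_nat.
apply: leq_sum_unique => [w /andP[/eqP wj _]|w w'|w].
- by apply: (oblique_arrow_le1 QN); rewrite vi wj eq_sym.
- move=> /andP[/eqP wj _] /andP[/eqP wj' _] Qvw Qvw'.
  by apply: (oblique_arrow_out QN _ _ Qvw Qvw'); rewrite ?vi wj ?wj' // eq_sym.
move=> /andP[/eqP wj pw] Qvw; have wi : tag w != i0 by rewrite wj.
have [_] := arrow_from_sweep wi vi pv Qvw; rewrite wj => /(_ pj)[w' [wj' pw' Qwv]].
by exists w' => //; apply/andP; split; first exact/eqP.
Qed.

Lemma omega_flow m (u : vertex k -> int) :
  omega Q u (prefix_diff i0 (p i0) (p i0 + m.+1)) = \sum_w u w * flow m w.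
Proof.
apply: eq_bigr => w _; rewrite /flow mulr_sumr [RHS]big_mkcond.
apply: eq_bigr => v _; rewrite prefix_diffE ?leq_addr //.
by case: (_ && _); rewrite ?mulr1 ?mulr0 ?mul0r.
Qed.

(** The three cases are the three shapes of c-vectors in the chain [j], listed
in the places of its word: still increasing, already decreasing, and the drop
between them, which exists only if [j] has been swept at least once. *)
Lemma omega_cross_chain m j l : j != i0 -> (l < k j)%N ->
  omega Q (prefix_diff j (word (k j) (p j) 0 l) (word (k j) (p j) 0 l.+1))
    (prefix_diff i0 (p i0) (p i0 + m.+1)) <= 0.
Proof.
move=> ji lk; have pk := p_le j; rewrite omega_flow.
have word0 t : word (k j) (p j) 0 t = (if t <= k j - p j then p j + t else k j - t)%N.
  by rewrite /word; case: eqP => [->|_]; rewrite ?addn0.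
rewrite !word0; case: (ltngtP l (k j - p j)%N) => [lt_l|gt_l|lE].
- rewrite ?(ltnW lt_l) sum_prefix_diff; last by lia.
  apply: sumr_le0 => w /andP[/eqP wj /andP[pw _]].
  have pwj : p (tag w) = p j by rewrite wj.
  by apply: flow_unprocessed; rewrite ?wj // pwj; lia.
- under eq_bigr do rewrite prefix_diffN mulNr.
  rewrite sumrN oppr_le0 sum_prefix_diff; last by lia.
  apply: sumr_ge0 => w /andP[/eqP wj /andP[_ wp]].
  have pwj : p (tag w) = p j by rewrite wj.
  by apply: flow_processed; rewrite ?wj // pwj; lia.
under eq_bigr do rewrite prefix_diffN mulNr.
rewrite sumrN oppr_le0 sum_prefix_diff; last by lia.
have pj : (0 < p j)%N by lia.
apply: le_trans (sum_flow_ge0 m ji pj) _; rewrite le_eqVlt; apply/orP; left.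
apply/eqP; apply: eq_bigl => w; case: eqP => //= wj.
have kw : k (tag w) = k j by rewrite wj.
have wk : (tagged w < k j)%N by rewrite -kw ltn_tagged.
by move: (tagged w : nat) wk => t; lia.
Qed.

Definition sweep_words m i := word (k i) (p i) (if i == i0 then m else 0%N).

Lemma sweep_cvector m z : tag z = i0 -> tagged z = m :> nat -> (m < k i0 - p i0)%N ->
  word_cvector (sweep_words m) z =1 prefix_diff i0 (p i0) (p i0 + m.+1).
Proof.
move=> zi zm mk f; rewrite /word_cvector /sweep_words zm zi eqxx.
rewrite /word ltnn eqxx ltnNge leqnSn /=.
by rewrite mk; case: eqP => //; lia.
Qed.

Lemma sweep_green m z f : tag z = i0 -> tagged z = m :> nat -> (m < k i0 - p i0)%N ->
  0 <= word_cvector (sweep_words m) z f.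
Proof. by move=> zi zm mk; rewrite sweep_cvector // prefix_diffE ?leq_addr. Qed.

(** The mutated vertex receives exactly one arrow from each of its neighbours in
the chain.  As the values at the exchanged places are p and p+m+1, the sign
formula only distinguishes values between these two, equal to one of them, and
outside. *)
Lemma omega_same_chain m l : (m < k i0 - p i0)%N -> (l < k i0)%N -> l != m ->
  Num.max 0 (omega Q (prefix_diff i0 (word (k i0) (p i0) m l) (word (k i0) (p i0) m l.+1))
    (prefix_diff i0 (p i0) (p i0 + m.+1))) = ((l.+1 == m) || (l == m.+1))%:Z.
Proof.
move=> mk lk lm; have pk := p_le i0.
have W_le t : (t <= k i0)%N -> (word (k i0) (p i0) m t <= k i0)%N.
  by rewrite /word; do 3?case: ifP; lia.
rewrite (omega_prefix_diff QN) ?W_le ?(ltnW lk) //; try lia.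
have [lt_lm|ge_lm] := ltnP l.+1 m.
  by rewrite !word_lt ?(ltnW lt_lm) // /sgn_diff; lia.
have [->|Dl] := eqVneq m l.+1.
  by rewrite word_eq word_lt // /sgn_diff; lia.
have outside t := @word_outside (k i0) (p i0) m t.
have [lE|Dm] := eqVneq l m.+1.
  subst l; have := outside m.+2; rewrite word_succ // ltnSn lk => /(_ isT mk).
  by rewrite /sgn_diff; lia.
have ml : (m.+1 < l)%N by lia.
have := outside l; have := outside l.+1; rewrite ml (leqW ml) lk (ltnW lk) /=.
move=> /(_ isT mk) o1 /(_ isT mk) o2; rewrite /sgn_diff; lia.
Qed.

(** Adding E(p+m+1) - E(p) to the two neighbours exchanges the values of the
word at the places m and m+1. *)
Lemma sweep_mutation m z y f :
  tag z = i0 -> tagged z = m :> nat -> (m < k i0 - p i0)%N ->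
  green_cvector Q (word_cvector (sweep_words m)) z y f =
    word_cvector (sweep_words m.+1) y f.
Proof.
move=> zi zm mk; rewrite /green_cvector.
rewrite (eq_omega Q (fun=> erefl) (sweep_cvector zi zm mk)) sweep_cvector //.
have [yi|yi] := eqVneq (tag y) i0; last first.
  have -> : (y == z) = false by apply: contraNF yi => /eqP->; rewrite zi.
  have := omega_cross_chain m yi (ltn_tagged y).
  rewrite /word_cvector /sweep_words (negbTE yi).
  set o := omega _ _ _; move=> o0; have -> : Num.max 0 o = 0 by lia.
  by rewrite mul0r addr0.
have yz : (y == z) = (tagged y == m :> nat).
  by apply/eqP/eqP => [->//|ym]; apply: vertex_inj; rewrite ?zi ?zm.
rewrite yz /word_cvector /sweep_words; have := ltn_tagged y; move: (tagged y : nat) => l.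
rewrite yi eqxx => lk; case: eqVneq => [->|lm].
  by rewrite -prefix_diffN !word_step !eqxx gtn_eqF.
rewrite omega_same_chain // /prefix_diff !word_step (negbTE lm) eqSS (negbTE lm).
have [lm1|_] := eqVneq l.+1 m.
  have -> : (l == m.+1) = false by lia.
  rewrite -lm1 word_eq (word_lt _ _ (ltnSn l)) /= addnS; ring.
have [lm1|_] := eqVneq l m.+1.
  by rewrite lm1 word_succ //=; ring.
by rewrite mul0r addr0.
Qed.

Local Close Scope ring_scope.

Lemma sweep_run (R : ice_quiver (vertex k + vertex k)%type) m s :
  map (@label N k) s = [seq (tag x0, l) | l <- iota m.+1 (size s)] ->
  m + size s <= k (tag x0) - p (tag x0) ->
  has_cvectors Q (word_cvector (sweep_words m)) R ->
  green_run R s /\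
  has_cvectors Q (word_cvector (sweep_words (m + size s))) (mutations R (map inl s)).
Proof.
elim: s m R => [|z s IH] m R /=; first by rewrite addn0.
case=> zi zm ls mk cR; have mk' : m < k (tag x0) - p (tag x0).
  by apply: leq_trans mk; rewrite addnS ltnS leq_addr.
have gz f := sweep_green f zi zm mk'.
have [] := IH m.+1 (mutation R (inl z)) ls.
- by rewrite addSnnS.
- apply: eq_has_cvectors (green_mutation_cvectors cR gz) => y f.
  exact: (sweep_mutation y f zi zm mk').
rewrite addSnnS => gs cs; split=> //; split=> //; exact: cvector_green cR gz.
Qed.

Lemma underline_mu_run (R : ice_quiver (vertex k + vertex k)%type) :
  has_cvectors Q (swept_cvector p) R ->
  green_run R (underline_mu x0) /\
  has_cvectors Q (swept_cvector (incr_at i0 p)) (mutations R (map inl (underline_mu x0))).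
Proof.
move=> cR; have lmu := label_underline_mu x0.
have szmu : size (underline_mu x0) = k (tag x0) - p (tag x0).
  by rewrite -(size_map (@label N k)) lmu size_map size_iota x0p.
have [] := sweep_run (R := R) (m := 0) (s := underline_mu x0).
- by rewrite lmu szmu x0p.
- by rewrite szmu.
- apply: eq_has_cvectors cR => y f; rewrite /swept_cvector /word_cvector /sweep_words.
  by rewrite !if_same.
move=> gs cs; split=> //; apply: eq_has_cvectors cs => y f.
rewrite add0n szmu /swept_cvector /word_cvector /sweep_words /incr_at.
have := ltn_tagged y.
case: eqP => [yi|_]; last by rewrite addn0.
have := ltn_tagged x0; rewrite x0p => pk.
move: (tagged y : nat) => l; rewrite yi addn1 => lk.
have word_full t : t <= k (tag x0) ->
    word (k (tag x0)) (p (tag x0)) (k (tag x0) - p (tag x0)) t =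
    word (k (tag x0)) (p (tag x0)).+1 0 t.
  move: (k _) (p _) pk => n q; clear => qn tn; rewrite /word.
  by do 6?case: ifP => ?; lia.
by rewrite !word_full // ltnW.
Qed.

End Sweep.

(** * The whole sequence *)

Section Run.
Variables (N : nat) (k : 'I_N -> nat) (Q : quiver (vertex k)).
Hypothesis QN : is_QN Q.

(** The hypothesis on [p] says that [s1], the part already processed, is an
initial piece of every chain. *)
Lemma run_suffix s1 s2 p (R : ice_quiver (vertex k + vertex k)%type) s :
  s = s1 ++ s2 -> uniq s -> (forall x, x \in s) ->
  (forall x y, gt_gen Q y x -> x <> y -> index y s < index x s) ->
  (forall i, p i <= k i) -> (forall y, (y \in s1) = (tagged y < p (tag y))) ->
  has_cvectors Q (swept_cvector p) R ->
  green_run R (flatten [seq underline_mu x | x <- s2]) /\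
  has_cvectors Q (swept_cvector k)
    (mutations R (map inl (flatten [seq underline_mu x | x <- s2]))).
Proof.
elim: s2 s1 p R => [|x s2 IH] s1 p R es us all_s ord p_le s1p cR /=.
  split=> //; apply: eq_has_cvectors cR => y f.
  have pk : p (tag y) = k (tag y).
    apply/eqP; rewrite eqn_leq p_le /= leqNgt; apply/negP => pk.
    have [u [ui ul]] := exists_vertex pk.
    have := all_s u; rewrite es cats0 s1p ul ui; lia.
  by rewrite /swept_cvector /word_cvector pk.
have x_s1 : x \notin s1.
  by move: us; rewrite es cat_uniq /= => /and3P[_ /norP[]].
have before z u : gt_gen Q z u -> z <> u -> u \in s1 \/ u = x -> z \in s1.
  move=> zu nzu u1; have := ord _ _ zu (nesym nzu); rewrite es !index_cat.
  case: ifP => // _; have := index_size u s1.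
  case: u1 => [->|->]; first by lia.
  by rewrite (negbTE x_s1) /= eqxx; lia.
(* The vertex of [x]'s chain directly before [x] is greater than [x], so it has
   been swept: [x] is the first unswept vertex of its chain. *)
have xp : tagged x = p (tag x) :> nat.
  apply/eqP; rewrite eqn_leq; have := x_s1; rewrite s1p -leqNgt => ->.
  rewrite andbT leqNgt; apply/negP => px.
  have [|u [ui ul]] := @exists_vertex _ k (tag x) (tagged x).-1.
    by have := ltn_tagged x; lia.
  have ux : gt_gen Q u x.
    by apply: gt_gen_vertical; rewrite ?ul ?prednK //; apply: leq_ltn_trans px.
  have nux : u <> x by move=> ux'; rewrite -ux' in ul px *; lia.
  have := before _ _ ux nux (or_intror erefl); rewrite s1p ul ui; lia.
have closed z u : gt_gen Q z u -> z <> u ->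
    tagged u < p (tag u) \/ u = x -> tagged z < p (tag z).
  by rewrite -!s1p; apply: before.
have [gx cx] := underline_mu_run QN p_le xp closed cR.
have [|||gs cs] := IH (rcons s1 x) (incr_at (tag x) p) _ _ us all_s ord _ _ cx.
- by rewrite cat_rcons.
- move=> i; rewrite /incr_at; case: eqP => [->|_]; rewrite ?addn0 ?addn1 //.
  by rewrite -xp ltn_tagged.
- move=> y; rewrite mem_rcons inE s1p /incr_at.
  have [yx|nyx] := eqVneq (tag y) (tag x); last first.
    by rewrite addn0; case: (y =P x) nyx => // ->; rewrite eqxx.
  have yx' : (y == x) = (tagged y == p (tag y) :> nat).
    apply/eqP/eqP => [->//|yp]; apply: vertex_inj => //; rewrite yp xp; congr p.
    exact: yx.
  by rewrite yx' addn1 ltnS [RHS]leq_eqVlt.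
by rewrite mutations_cat; split=> //; apply/green_run_cat.
Qed.
End Run.

Theorem theorem3p3 (N : nat) (k : 'I_N -> nat) (Q : quiver (vertex k))
    (s : seq (vertex k)) :
  1 <= N ->
  is_QN Q ->
  uniq s -> (forall x : vertex k, x \in s) ->
  (forall x y : vertex k, index x s < index y s -> ~ gt_vertex Q y x) ->
  maximal_green_sequence Q (flatten [seq underline_mu x | x <- s]).
Proof.
move=> _ QN us all_s ord.
have [] := @run_suffix N k Q QN [::] s (fun=> 0) (framed Q) s erefl us all_s.
- move=> x y yx nxy; case: ltngtP => // [xy|/(index_inj x (all_s y) (all_s x))].
    by case: (ord _ _ xy); apply: Relation_Operators.t_step.
  by move/esym.
- by [].
- by [].
- apply: eq_has_cvectors (framed_cvectors Q) => x f.
  have word_id n t : t <= n -> word n 0 0 t = t.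
    by rewrite /word subn0; case: eqP => [->|_ ->].
  have xk := ltn_tagged x.
  rewrite /swept_cvector /word_cvector !word_id ?(ltnW xk) // prefix_diffE // ltnS -eqn_leq.
  congr (Posz (nat_of_bool _)); apply/eqP/andP => [->|[/eqP fx /eqP xf]].
    by rewrite !eqxx.
  exact: vertex_inj.
move=> gs cs; split; first exact: green_run_sequence.
move=> x; apply: cvector_red cs _ => f.
have word_rev n t : word n n 0 t = n - t.
  by case: t => [|t]; rewrite /word subnn ?subn0.
rewrite /swept_cvector /word_cvector !word_rev prefix_diffN oppr_le0 prefix_diffE //.
exact: leq_sub2l.
Qed.
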